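(* Let $n\in\{2,3\}$, let $\Omega\subset\mathbb{R}^n$ be a convex Lipschitz domain which is the image of the reference domain $\hat\Omega$ under a smooth map $\boldsymbol{\varphi}:\hat\Omega\to\Omega$ whose Jacobian $\boldsymbol{J}$ satisfies $\det\boldsymbol{J}>0$, and let $1\le k_0\le k\le k_1$ be a wave number. Let $V_h\subset H^1(\Omega)$ be a finite-dimensional subspace with basis $\{\phi_i\}_{i=1}^N$ of functions of order $p\in\mathbb{N}$ on a grid of length $h$, where $p\ge c_p\log k_1$ and $h\le c_h\frac{\log k_1}{k_1}$ with suitable constants $c_p,c_h>0$ (as explained in the context). Assume that $\Omega$ has regularity $p-1$ and that $f\in H^{p-1}(\Omega)$ and $g\in H^{p-1/2}(\partial\Omega)$. Let $u\in H^1(\Omega)$ be the solution of the variational Helmholtz problem $$a(u,v)-k^2m(u,v)-k\,\mathrm{i}\,b(u,v)=\int_\Omega f\,\overline{v}\,dx+\int_{\partial\Omega}g\,\overline{v}\,dx\qquad\text{for all }v\in H^1(\Omega).$$ Let $H>0$ be the sampling length, let $\tilde{\mathsf K}$ and $\tilde{\mathsf M}$ be the surrogate stiffness and mass matrices ($N\times N$), and let $\tilde a(u,v)=\overline{\mathsf v}^{\mathsf T}\tilde{\mathsf K}\mathsf u$ and $\tilde m(u,v)=\overline{\mathsf v}^{\mathsf T}\tilde{\mathsf M}\mathsf u$ for $u,v\in V_h$ with coefficient vectors $\mathsf u,\mathsf v$ in the basis $\{\phi_i\}_{i=1}^N$. Let $q_1,q_2\in\mathbb{N}_0$ and assume that $$|a(u,v)-\tilde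 a(u,v)|\lesssim H^{q_1+1}\|\nabla u\|_{L^2(\Omega)}\|\nabla v\|_{L^2(\Omega)},\qquad |m(u,v)-\tilde m(u,v)|\lesssim H^{q_2+1}\|u\|_{L^2(\Omega)}\|v\|_{L^2(\Omega)}$$ for all $u,v\in V_h$. Then, for all sufficiently small $H$, the linear system $$\tilde{\mathsf K}\tilde{\mathsf u}-k^2\tilde{\mathsf M}\tilde{\mathsf u}-k\,\mathrm{i}\,\mathsf B\tilde{\mathsf u}=\mathsf f$$ has a unique solution $\tilde{\mathsf u}$, and $\tilde u_h=\sum_{i=1}^N\tilde{\mathsf u}_i\phi_i$ satisfies, with $q=\min\{q_1,q_2\}$, $$\|u-\tilde u_h\|_{\mathcal H}\lesssim (hk)^p\big(\|f\|_{H^{p-1}(\Omega)}+\|g\|_{H^{p-1/2}(\partial\Omega)}\big)+H^{q+1}\big(\|f\|_{L^2(\Omega)}+\|g\|_{L^2(\partial\Omega)}\big).$$ If, in addition, $g=0$ (and $f\in H^1(\Omega)$), then also $$\|u-\tilde u_h\|_{\mathcal H}\lesssim k^{-1}\big((hk)^p\|f\|_{H^{p-1}(\Omega)}+H^{q+1}\|f\|_{H^1(\Omega)}\big).$$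
   Context: Notation. The symbol $\lesssim$ denotes inequality up to a generic positive constant that is independent of $k$ and $h$ (and of $H$ and of the functions involved). All functions are complex-valued, $\mathrm{i}$ is the imaginary unit, and $$\|u\|_{\mathcal H}^2=\|\nabla u\|_{L^2(\Omega)}^2+k^2\|u\|_{L^2(\Omega)}^2.$$ The sesquilinear forms are $$a(u,v)=\int_\Omega\nabla u\cdot\nabla\overline{v}\,dx,\quad m(u,v)=\int_\Omega u\,\overline{v}\,dx,\quad b(u,v)=\int_{\partial\Omega}u\,\overline{v}\,dx.$$ The strong form of the problem is the Helmholtz equation with impedance boundary condition: $-\Delta u-k^2u=f$ in $\Omega$, $\frac{\partial u}{\partial n}-\mathrm{i}ku=g$ on $\partial\Omega$. Standard discretization. $u_h\in V_h$ denotes the solution of $a(u_h,v)-k^2m(u_h,v)-k\,\mathrm{i}\,b(u_h,v)=\int_\Omega f\overline{v}\,dx+\int_{\partial\Omega}g\overline{v}\,dx$ for all $v\in V_h$. The associated matrices and load vector are $\mathsf K_{ij}=a(\phi_j,\phi_i)$, $\mathsf M_{ij}=m(\phi_j,\phi_i)$, $\mathsf B_{ij}=b(\phi_j,\phi_i)$, $\mathsf f_i=\int_\Omega f\overline{\phi_i}\,dx+\int_{\partial\Omega}g\overline{\phi_i}\,dx$. Meaning of the suitable constants $c_p,c_h$. They are constants for which the known Helmholtz theory (Melenk; Melenk–Sauter; Cummings–Feng; Esterhazy–Melenk) applies to $V_h$ under the conditions $p\ge c_p\log k_1$, $h\le c_h\log k_1/k_1$. The facts recalled from this theory as part of the setting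 are: the continuous problem and the discrete problem for $u_h$ are uniquely solvable; $\|u\|_{\mathcal H}\lesssim\|f\|_{L^2(\Omega)}+\|g\|_{L^2(\partial\Omega)}$ for convex $\Omega$, and $\|u\|_{\mathcal H}\lesssim k^{-1}\|f\|_{H^1(\Omega)}$ if in addition $g=0$ and $f\in H^1(\Omega)$; $\|u-u_h\|_{\mathcal H}\lesssim(hk)^p(\|f\|_{H^{p-1}(\Omega)}+\|g\|_{H^{p-1/2}(\partial\Omega)})$ for convex domains with regularity $p-1$ and $f\in H^{p-1}(\Omega)$, $g\in H^{p-1/2}(\partial\Omega)$, and $\|u-u_h\|_{\mathcal H}\lesssim(hk)^pk^{-1}\|f\|_{H^{p-1}(\Omega)}$ if in addition $g=0$; and the uniform stability $\|u_h\|_{\mathcal H}\lesssim\|u\|_{\mathcal H}$. Surrogate matrices and sampling length. $\tilde{\mathsf K}\approx\mathsf K$ and $\tilde{\mathsf M}\approx\mathsf M$ are approximations (depending on $H$) of the stiffness and mass matrices; in the theorem the required approximation quality is expressed by the two displayed assumptions on $\tilde a$ and $\tilde m$. The matrix $\mathsf B$ is not approximated. In the isogeometric method, the matrix entries are regarded as values of functions (stencil functions) on the grid $\tilde{\mathbb X}$ of points $(\tilde x_{i_1},\dots,\tilde x_{i_n})$, $\tilde x_l=(l-\frac{p+1}{2})h$, $l=p+1,\dots,m-p$, $h=\frac{1}{m-p}$, where $m$ is the number of univariate B-splines per coordinate direction. These functions are replaced by B-spline interpolants with tensor-product, quasi-uniform knot vector $\tilde{\boldsymbol\Xi}=\tilde\Xi_1\times\cdots\times\tilde\Xi_n$,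 whose knots $\tilde{\boldsymbol\xi}_{\boldsymbol i}$ are taken from a subset $\tilde{\mathbb X}^{\mathrm s}\subseteq\tilde{\mathbb X}$ of sample points. The sampling length is $$H=\max_{|\boldsymbol j|=1,\ \boldsymbol i}\big\{\|\tilde{\boldsymbol\xi}_{\boldsymbol i+\boldsymbol j}-\tilde{\boldsymbol\xi}_{\boldsymbol i}\|_\infty:\ \tilde{\boldsymbol\xi}_{\boldsymbol i},\tilde{\boldsymbol\xi}_{\boldsymbol i+\boldsymbol j}\in\tilde{\boldsymbol\Xi}\big\},$$ where $\boldsymbol i,\boldsymbol j$ are multi-indices. *)

(* Defs.v *)
From HB Require Import structures.
From mathcomp Require Import all_boot all_order all_algebra.
From mathcomp Require Import all_classical all_reals all_analysis.
From mathcomp Require Import measurable_realfun complex ring lra.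

Set Implicit Arguments.
Unset Strict Implicit.
Unset Printing Implicit Defensive.

Import Order.TTheory GRing.Theory Num.Theory.
Import numFieldNormedType.Exports.
Import Normc.

Local Open Scope classical_set_scope.
Local Open Scope ring_scope.

(* Measures on R^n come from outer measures by Caratheodory's construction: the
   measurable sets are the Caratheodory-measurable ones. *)

Section outer_measures.
Context {R : realType} {n : nat}.
Implicit Types (x y : 'rV[R]_n) (A : set 'rV[R]_n).

Definition dotv x y : R := (x *m y^T) ord0 ord0.

(* The library's norm on ['rV[R]_n] is the maximum norm. *)
Definition enorm x : R := Num.sqrt (dotv x x).

Definition width (i : 'I_n) A : \bar R :=
  ereal_sup [set (`|xy.1 ord0 i - xy.2 ord0 i|)%:E | xy in A `*` A].

(* Volume of the smallest axis-parallel box that contains [A]; covering by any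
   sets with this gauge amounts to covering by boxes. *)
Definition box_gauge A : \bar R :=
  if `[< A = set0 >] then 0%E else (\big[*%E/1%E]_i width i A)%E.

Definition diameter A : \bar R :=
  ereal_sup [set (enorm (xy.1 - xy.2))%:E | xy in A `*` A].

Definition diam_gauge (c : {nonneg R}) (s : nat) (delta : R) A : \bar R :=
  if `[< A = set0 >] then 0%E
  else if (diameter A <= delta%:E)%E then (c%:num * (fine (diameter A) / 2) ^+ s)%:E
  else +oo%E.

(* [mu_ext gauge A] is the infimum of [\sum_k gauge (F k)] over the countable
   covers [F] of [A]; any sets are admitted in a cover. *)
Definition cover_measure (gauge : set 'rV[R]_n -> \bar R) A : \bar R :=
  @mu_ext _ (g_sigma_algebraType [set: set 'rV[R]_n]) R gauge A.

Definition lebesgue_outer : set 'rV[R]_n -> \bar R := cover_measure box_gauge.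

Definition hausdorff_outer (c : {nonneg R}) (s : nat) A : \bar R :=
  ereal_sup [set cover_measure (diam_gauge c s delta) A | delta in [set d : R | 0 < d]].

Let width_ge0 i A : A !=set0 -> (0 <= width i A)%E.
Proof.
move=> [x Ax]; by apply: ereal_sup_ubound; exists (x, x) => //=; rewrite subrr normr0.
Qed.

Let box_gauge_ge0 A : (0 <= box_gauge A)%E.
Proof.
rewrite /box_gauge; case: asboolP => // /eqP/set0P A0.
by elim/big_ind : _ => // [x y x0 y0|i _]; [exact: mule_ge0|exact: width_ge0].
Qed.

Let box_gauge0 : box_gauge set0 = 0%E.
Proof. by rewrite /box_gauge; case: asboolP. Qed.

Let diam_gauge_ge0 c s delta A : (0 <= diam_gauge c s delta A)%E.
Proof.
rewrite /diam_gauge; case: asboolP => // /eqP/set0P[x Ax]; case: ifP => // _.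
rewrite lee_fin mulr_ge0// exprn_ge0// divr_ge0// fine_ge0//.
apply: ereal_sup_ubound; exists (x, x) => //=.
by rewrite subrr /enorm /dotv mul0mx mxE sqrtr0.
Qed.

Let diam_gauge0 c s delta : diam_gauge c s delta set0 = 0%E.
Proof. by rewrite /diam_gauge; case: asboolP. Qed.

HB.instance Definition _ := @isOuterMeasure.Build R 'rV[R]_n lebesgue_outer
  (@mu_ext0 _ (g_sigma_algebraType [set: set 'rV[R]_n]) _ _ box_gauge0 box_gauge_ge0)
  (@mu_ext_ge0 _ (g_sigma_algebraType [set: set 'rV[R]_n]) _ _ box_gauge_ge0)
  (@le_mu_ext _ (g_sigma_algebraType [set: set 'rV[R]_n]) _ _)
  (@mu_ext_sigma_subadditive _ (g_sigma_algebraType [set: set 'rV[R]_n]) _ _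
     box_gauge_ge0).

Let cover_ge0 c s delta A : (0 <= cover_measure (diam_gauge c s delta) A)%E.
Proof.
exact: (@mu_ext_ge0 _ (g_sigma_algebraType [set: set 'rV[R]_n]) _ _
  (diam_gauge_ge0 c s delta)).
Qed.

Let hausdorff_outer_ge0 c s A : (0 <= hausdorff_outer c s A)%E.
Proof.
apply: le_trans (cover_ge0 c s 1 A) (ereal_sup_ubound _).
by exists 1 => //=; exact: ltr01.
Qed.

Let hausdorff_outer0 c s : hausdorff_outer c s set0 = 0%E.
Proof.
apply/eqP; rewrite eq_le hausdorff_outer_ge0 andbT.
apply: ge_ereal_sup => _ [delta _ <-].
by rewrite /cover_measure (@mu_ext0 _ (g_sigma_algebraType [set: set 'rV[R]_n]) _ _
  (diam_gauge0 c s delta) (diam_gauge_ge0 c s delta)).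
Qed.

Let le_hausdorff_outer c s : {homo hausdorff_outer c s : A B / A `<=` B >-> (A <= B)%E}.
Proof.
move=> A B AB; apply: ge_ereal_sup => _ [delta d0 <-].
apply: (@le_trans _ _ (cover_measure (diam_gauge c s delta) B)).
  exact: (@le_mu_ext _ (g_sigma_algebraType [set: set 'rV[R]_n])).
by apply: ereal_sup_ubound; exists delta.
Qed.

Let hausdorff_outer_sigma_subadditive c s : sigma_subadditive (hausdorff_outer c s).
Proof.
move=> F; apply: ge_ereal_sup => _ [delta d0 <-].
apply: le_trans (@mu_ext_sigma_subadditive _
  (g_sigma_algebraType [set: set 'rV[R]_n]) _ _ (diam_gauge_ge0 c s delta) F) _.
apply: lee_nneseries => i _; first by move=> _; exact: cover_ge0.
by apply: ereal_sup_ubound; exists delta.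
Qed.

HB.instance Definition _ c s := @isOuterMeasure.Build R 'rV[R]_n (hausdorff_outer c s)
  (hausdorff_outer0 c s) (hausdorff_outer_ge0 c s) (@le_hausdorff_outer c s)
  (@hausdorff_outer_sigma_subadditive c s).

End outer_measures.

Definition cara_measure (R : realType) (T : pointedType)
    (mu : {outer_measure set T -> \bar R}) : {measure set (caratheodory_type mu) -> \bar R} :=
  [the measure _ _ of (mu : set (caratheodory_type mu) -> _)].

Section measures.
Context (R : realType) (n : nat).

Definition leb := cara_measure (@lebesgue_outer R n).

Let ball_volume_ge0 : 0 <= fine (lebesgue_outer [set x : 'rV[R]_n | enorm x <= 1]).
Proof. exact/fine_ge0/outer_measure_ge0. Qed.

Definition ball_volume : {nonneg R} := NngNum ball_volume_ge0.

End measures.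

(* The (n-1)-dimensional Hausdorff measure, normalised so as to be the surface
   measure on Lipschitz hypersurfaces. *)
Definition surf_outer (R : realType) (n : nat) : {outer_measure set 'rV[R]_n -> \bar R} :=
  hausdorff_outer (ball_volume R n.-1) n.-1.

Definition surf (R : realType) (n : nat) := cara_measure (surf_outer R n).

(* A function on a subset [D] is represented by a function on the whole space
   whose values outside [D] are irrelevant; [f \_ D] is the extension by zero. *)

Section complex_integral.
Context d (T : measurableType d) (R : realType) (mu : {measure set T -> \bar R}).
Implicit Types (D : set T) (f g : T -> R[i]).

Definition cintegrable D f :=
  mu.-integrable setT (EFin \o ((fun x => complex.Re (f x)) \_ D)) /\
  mu.-integrable setT (EFin \o ((fun x => complex.Im (f x)) \_ D)).

Definition cint D f : R[i] :=
  Complex (\int[mu]_(x in D) complex.Re (f x)) (\int[mu]_(x in D) complex.Im (f x)).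

Definition sq_integrable D f :=
  [/\ measurable_fun setT ((fun x => complex.Re (f x)) \_ D),
      measurable_fun setT ((fun x => complex.Im (f x)) \_ D) &
      mu.-integrable setT (EFin \o ((fun x => normc (f x) ^+ 2) \_ D))].

Definition norm2 D f : R := Num.sqrt (\int[mu]_(x in D) (normc (f x) ^+ 2)).

Definition eq_ae D f g := {ae mu, forall x, D x -> f x = g x}.

Let restrE D (F : T -> R) x : (F \_ D) x = if x \in D then F x else 0.
Proof. by rewrite /patch; case: ifP. Qed.

Let RintegralE D (F : T -> R) : \int[mu]_(x in D) F x = \int[mu]_x (F \_ D) x.
Proof. by rewrite /Rintegral integral_mkcond restrict_EFin. Qed.

Let ReZD D a f g :
  (fun x => complex.Re (a * f x + g x)) \_ D =
  fun x => complex.Re a * ((fun x => complex.Re (f x)) \_ D) x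
    - complex.Im a * ((fun x => complex.Im (f x)) \_ D) x
    + ((fun x => complex.Re (g x)) \_ D) x.
Proof.
apply/funext => x; rewrite !restrE; case: ifP => _; last by rewrite !mulr0 subr0 addr0.
by case: a (f x) (g x) => [? ?] [? ?] [? ?].
Qed.

Let ImZD D a f g :
  (fun x => complex.Im (a * f x + g x)) \_ D =
  fun x => complex.Re a * ((fun x => complex.Im (f x)) \_ D) x
    + complex.Im a * ((fun x => complex.Re (f x)) \_ D) x
    + ((fun x => complex.Im (g x)) \_ D) x.
Proof.
apply/funext => x; rewrite !restrE; case: ifP => _; last by rewrite !mulr0 !addr0.
by case: a (f x) (g x) => [? ?] [? ?] [? ?].
Qed.

Let integrableZDD (a b : R) (F G H : T -> R) :
  mu.-integrable setT (EFin \o F) -> mu.-integrable setT (EFin \o G) ->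
  mu.-integrable setT (EFin \o H) ->
  mu.-integrable setT (EFin \o (fun x => a * F x + b * G x + H x)).
Proof.
move=> iF iG iH.
have : mu.-integrable setT
    ((fun x => a%:E * (EFin \o F) x)%E \+ (fun x => b%:E * (EFin \o G) x)%E \+ (EFin \o H))%E.
  by do 2?[apply: integrableD => //]; exact: integrableZl.
by apply: eq_integrable.
Qed.

Let RintegralZDD (a b : R) (F G H : T -> R) :
  mu.-integrable setT (EFin \o F) -> mu.-integrable setT (EFin \o G) ->
  mu.-integrable setT (EFin \o H) ->
  \int[mu]_x (a * F x + b * G x + H x) =
  a * \int[mu]_x F x + b * \int[mu]_x G x + \int[mu]_x H x.
Proof.
move=> iF iG iH.
have Z c K : mu.-integrable setT (EFin \o K) ->
    mu.-integrable setT (EFin \o (fun x => c * K x)).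
  by move=> iK; apply: eq_integrable (integrableZl measurableT c iK).
have iab : mu.-integrable setT (EFin \o (fun x => a * F x + b * G x)).
  by apply: eq_integrable (integrableD measurableT (Z a F iF) (Z b G iG)).
by rewrite RintegralD// RintegralD ?RintegralZl//; exact: Z.
Qed.

Lemma cintegrableZD D (a : R[i]) f g :
  cintegrable D f -> cintegrable D g -> cintegrable D (fun x => a * f x + g x).
Proof.
move=> [fR fI] [gR gI]; split; rewrite ?ReZD ?ImZD; last exact: integrableZDD.
by under [X in _ \o X]eq_fun do rewrite -mulNr; exact: integrableZDD.
Qed.

Lemma cintZD D (a : R[i]) f g : cintegrable D f -> cintegrable D g ->
  cint D (fun x => a * f x + g x) = a * cint D f + cint D g.
Proof.
move=> [fR fI] [gR gI]; rewrite /cint !(RintegralE D) ReZD ImZD.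
under eq_Rintegral do rewrite -mulNr.
rewrite !RintegralZDD//; case: a => p q.
by congr Complex => /=; rewrite ?mulNr.
Qed.

Lemma sq_integrable0 D : sq_integrable D (fun=> 0).
Proof.
have E : (fun=> 0 : R) \_ D = fun=> 0.
  by apply/funext => x; rewrite restrE; case: ifP.
split; rewrite ?normc0 ?expr0n E//.
exact: integrable0.
Qed.

Lemma sq_integrableZD D (a : R[i]) f g :
  sq_integrable D f -> sq_integrable D g -> sq_integrable D (fun x => a * f x + g x).
Proof.
move=> [fR fI fi] [gR gI gi].
have mR : measurable_fun setT ((fun x => complex.Re (a * f x + g x)) \_ D).
  rewrite ReZD; apply: measurable_funD => //; apply: measurable_funB => //;
  exact: measurable_funM.
have mI : measurable_fun setT ((fun x => complex.Im (a * f x + g x)) \_ D).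
  rewrite ImZD; apply: measurable_funD => //; apply: measurable_funD => //;
  exact: measurable_funM.
split=> //.
have nE (z : R[i]) : normc z ^+ 2 = complex.Re z ^+ 2 + complex.Im z ^+ 2.
  by case: z => x y /=; rewrite sqr_sqrtr// addr_ge0 ?sqr_ge0.
apply: (@le_integrable _ _ _ _ _ _ _
  (EFin \o (fun x => (2 * normc a ^+ 2) * ((fun x => normc (f x) ^+ 2) \_ D) x
    + 2 * ((fun x => normc (g x) ^+ 2) \_ D) x + 0))) => //.
- apply/measurable_EFinP.
  rewrite (_ : _ \_ D = fun x => (((fun x => complex.Re (a * f x + g x)) \_ D) x) ^+ 2
     + (((fun x => complex.Im (a * f x + g x)) \_ D) x) ^+ 2).
    by apply: measurable_funD; exact: measurable_funX.
  apply/funext => x; rewrite !restrE; case: ifP => _; first by rewrite nE.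
  by rewrite expr0n addr0.
- move=> x _ /=; rewrite lee_fin !restrE addr0; case: ifP => _; last first.
    by rewrite normr0 mulr0 mulr0 addr0 normr0.
  rewrite ger0_norm ?sqr_ge0// ger0_norm; last first.
    by rewrite addr_ge0// mulr_ge0// ?sqr_ge0// mulr_ge0// sqr_ge0.
  rewrite !nE; case: (f x) (g x) (a) => [r s] [u v] [p q] /=.
  rewrite -subr_ge0.
  rewrite (_ : _ - _ = (p * r - q * s - u) ^+ 2 + (p * s + q * r - v) ^+ 2).
    by rewrite addr_ge0 ?sqr_ge0.
  by ring.
- by apply: integrableZDD => //; exact: integrable0.
Qed.

End complex_integral.

Section smooth.
Context {R : realType} {n : nat} {W : normedModType R}.
Implicit Types f : 'rV[R]_n -> W.

Definition partial (i : 'I_n) f : 'rV[R]_n -> W := fun x => 'D_(delta_mx ord0 i) f x.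

Definition smooth_on (U : set 'rV[R]_n) f :=
  forall s : seq 'I_n, let g := foldr partial f s in
  forall x, U x -> {for x, continuous g} /\ forall i, derivable g x (delta_mx ord0 i).

Definition mderiv (al : {ffun 'I_n -> nat}) f : 'rV[R]_n -> W :=
  foldr (fun i => iter (al i) (partial i)) f (enum 'I_n).

End smooth.

Section sobolev.
Context {R : realType} {n : nat}.
Implicit Types (Om : set 'rV[R]_n) (al : {ffun 'I_n -> nat}).

Definition test_function Om (psi : 'rV[R]_n -> R) :=
  smooth_on setT psi /\
  exists2 K, compact K /\ K `<=` Om & forall x, ~ K x -> psi x = 0.

Definition morder al : nat := \sum_i al i.

Definition weak_derivative Om al (u w : 'rV[R]_n -> R[i]) :=
  forall psi, test_function Om psi ->
  let lhs x := (mderiv al psi x)%:C%C * u x in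
  let rhs x := (psi x)%:C%C * w x in
  [/\ cintegrable (leb R n) Om lhs, cintegrable (leb R n) Om rhs &
      cint (leb R n) Om lhs = (-1) ^+ morder al * cint (leb R n) Om rhs].

Definition jet := {ffun 'I_n -> nat} -> 'rV[R]_n -> (R[i])^o.

Definition sobolev_jet Om (m : nat) : {pred jet} := fun J =>
  `[< forall al, (morder al <= m)%N ->
      sq_integrable (leb R n) Om (J al) /\ weak_derivative Om al (J [ffun=> 0%N]) (J al) >].

Lemma sobolev_jet_submod_closed Om m : submod_closed (sobolev_jet Om m).
Proof.
split=> [|a J K]; first (apply/asboolP => al _; split).
- exact: sq_integrable0.
- move=> psi _ lhs rhs.
  have E : rhs = lhs by apply/funext => x; rewrite /lhs /rhs !mulr0.
  have i0 : cintegrable (leb R n) Om lhs.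
    rewrite (_ : lhs = fun=> 0); last by apply/funext => x; rewrite /lhs mulr0.
    split; rewrite (_ : _ \_ Om = fun=> 0) ?integrable0//;
      by apply/funext => x; rewrite /patch; case: ifP.
  rewrite E; split=> //.
  have -> : cint (leb R n) Om lhs = 0; last by rewrite mulr0.
  rewrite (_ : lhs = fun=> 0); last by apply/funext => x; rewrite /lhs mulr0.
  by rewrite /cint /Rintegral integral0.
- move=> /asboolP HJ /asboolP HK; apply/asboolP => al alm.
  have [J2 Jw] := HJ al alm; have [K2 Kw] := HK al alm.
  split; first exact: sq_integrableZD.
  move=> psi psiT lhs rhs; have [Ji Ji' JE] := Jw psi psiT.
  have [Ki Ki' KE] := Kw psi psiT.
  have distr (c u v : R[i]) : c * (a * u + v) = a * (c * u) + c * v by ring.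
  have -> : lhs = fun x => a * ((mderiv al psi x)%:C%C * J [ffun=> 0%N] x)
                            + (mderiv al psi x)%:C%C * K [ffun=> 0%N] x.
    by apply/funext => x; exact: distr.
  have -> : rhs = fun x => a * ((psi x)%:C%C * J al x) + (psi x)%:C%C * K al x.
    by apply/funext => x; exact: distr.
  split; [exact: cintegrableZD|exact: cintegrableZD|].
  by rewrite !cintZD// JE KE; ring.
Qed.

HB.instance Definition _ Om m :=
  GRing.isSubmodClosed.Build _ _ (sobolev_jet Om m) (sobolev_jet_submod_closed Om m).

(* An element of H^m(Om) is stored together with its weak derivatives up to
   order [m].  These are determined almost everywhere by the function, so this
   is no additional data; components of higher order are irrelevant. *)
Record sobolev Om m := Sobolev { wderiv : jet; sobolevP : wderiv \in sobolev_jet Om m }.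

HB.instance Definition _ Om m := [isSub for @wderiv Om m].
HB.instance Definition _ Om m := [Choice of sobolev Om m by <:].
HB.instance Definition _ Om m := [SubChoice_isSubLmodule of sobolev Om m by <:].

End sobolev.

Section norms_and_forms.
Context {R : realType} {n : nat} {Om : set 'rV[R]_n}.

Definition fn m (u : sobolev Om m) : 'rV[R]_n -> R[i] := wderiv u [ffun=> 0%N].

Definition grad (u : sobolev Om 1) (i : 'I_n) : 'rV[R]_n -> R[i] :=
  wderiv u [ffun j => nat_of_bool (j == i)].

Definition sobolev_norm m (u : sobolev Om m) : R :=
  Num.sqrt (\sum_(al : {ffun 'I_n -> 'I_m.+1} | (\sum_i al i <= m)%N)
    norm2 (leb R n) Om (wderiv u [ffun i => nat_of_ord (al i)]) ^+ 2).

Definition grad_norm (u : sobolev Om 1) : R :=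
  Num.sqrt (\sum_(i < n) norm2 (leb R n) Om (grad u i) ^+ 2).

Definition energy_norm (k : R) (u : sobolev Om 1) : R :=
  Num.sqrt (grad_norm u ^+ 2 + k ^+ 2 * norm2 (leb R n) Om (fn u) ^+ 2).

Definition form_a (u v : sobolev Om 1) : R[i] :=
  cint (leb R n) Om (fun x => \sum_(i < n) grad u i x * conjc (grad v i x)).

Definition form_m (u v : sobolev Om 1) : R[i] :=
  cint (leb R n) Om (fun x => fn u x * conjc (fn v x)).

End norms_and_forms.

Section domains.
Context {R : realType} {n : nat}.
Implicit Types Om : set 'rV[R]_n.

Definition is_domain Om := [/\ open Om, Om !=set0 & connected Om].

Definition boundary Om := closure Om `\` interior Om.

(* Near each boundary point [Om] is, for a suitable unit vector [e], the set of
   the points above the graph of a Lipschitz function over the hyperplane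
   orthogonal to [e]. *)
Definition lipschitz_boundary Om :=
  forall x, boundary Om x ->
  exists (r L : R) (e : 'rV[R]_n) (gam : 'rV[R]_n -> R),
    [/\ 0 < r, dotv e e = 1,
        forall y z, `|gam y - gam z| <= L * enorm (y - z) &
        forall y, enorm (y - x) < r ->
          (Om y <-> gam (y - dotv y e *: e) < dotv y e)].

Definition lipschitz_domain Om :=
  [/\ is_domain Om, bounded_set Om & lipschitz_boundary Om].

(* The trace operator of H^1(Om): the bounded linear operator into the square
   integrable functions on the boundary that restricts functions which are
   continuous up to the boundary. *)
Record trace_operator Om := TraceOperator {
  tr :> sobolev Om 1 -> 'rV[R]_n -> R[i];
  tr_sq_integrable : forall u, sq_integrable (surf R n) (boundary Om) (tr u);
  tr_linear : forall (c : R[i]) u v, eq_ae (surf R n) (boundary Om)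
    (tr (c *: u + v)) (fun x => c * tr u x + tr v x);
  tr_bounded : exists C : R, forall u,
    norm2 (surf R n) (boundary Om) (tr u) <= C * sobolev_norm u;
  tr_restriction : forall u (U : 'rV[R]_n -> R[i]),
    {within closure Om, continuous (fun x => complex.Re (U x))} ->
    {within closure Om, continuous (fun x => complex.Im (U x))} ->
    eq_ae (leb R n) Om (fn u) U -> eq_ae (surf R n) (boundary Om) (tr u) U }.

End domains.

Section boundary_value_problem.
Context {R : realType} {n : nat} {Om : set 'rV[R]_n} (T : trace_operator Om).
Implicit Types (f g : 'rV[R]_n -> R[i]) (u v : sobolev Om 1) (k : R).

Definition form_b u v : R[i] :=
  cint (surf R n) (boundary Om) (fun x => T u x * conjc (T v x)).

Definition load f g v : R[i] :=
  cint (leb R n) Om (fun x => f x * conjc (fn v x)) +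
  cint (surf R n) (boundary Om) (fun x => g x * conjc (T v x)).

Definition helmholtz k u v : R[i] :=
  form_a u v - (k ^+ 2)%:C%C * form_m u v - k%:C%C * 'i%C * form_b u v.

Definition weak_solution k f g u := forall v, helmholtz k u v = load f g v.

(* H^{s-1/2} of the boundary, for [0 < s], is the space of the traces of the
   functions in H^s(Om), with the quotient norm. *)
Definition extends_boundary s (G : sobolev Om s) g :=
  exists2 U : sobolev Om 1, eq_ae (leb R n) Om (fn U) (fn G) &
    eq_ae (surf R n) (boundary Om) (T U) g.

Definition trace_space s g := exists G : sobolev Om s, extends_boundary G g.

Definition trace_norm s g : R :=
  inf [set r | exists2 G : sobolev Om s, extends_boundary G g & r = sobolev_norm G].

(* Elliptic shift by two for -Laplace(u) + u = f with Neumann data g. *)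
Definition has_regularity s :=
  exists C : R, forall (f : sobolev Om s) g u, trace_space s.+1 g ->
    (forall v, form_a u v + form_m u v = load (fn f) g v) ->
    exists2 U : sobolev Om s.+2, eq_ae (leb R n) Om (fn u) (fn U) &
      sobolev_norm U <= C * (sobolev_norm f + trace_norm s.+1 g).

End boundary_value_problem.

Section discretization.
Context {R : realType} {n : nat} {Om : set 'rV[R]_n} (T : trace_operator Om).
Context {N : nat} (phi : 'I_N -> sobolev Om 1).
Implicit Types (f g : 'rV[R]_n -> R[i]) (k : R) (c d : 'cV[R[i]]_N).

Definition comb c : sobolev Om 1 := \sum_(i < N) c i ord0 *: phi i.

Definition lin_indep :=
  forall c, eq_ae (leb R n) Om (fn (comb c)) (fun=> 0) -> c = 0.

Definition stiffness : 'M[R[i]]_N := \matrix_(i, j) form_a (phi j) (phi i).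
Definition mass : 'M[R[i]]_N := \matrix_(i, j) form_m (phi j) (phi i).
Definition bmass : 'M[R[i]]_N := \matrix_(i, j) form_b T (phi j) (phi i).
Definition load_vector f g : 'cV[R[i]]_N := \col_i load T f g (phi i).

(* The value at [u = comb c], [v = comb d] of the form with matrix [A]. *)
Definition matrix_form (A : 'M[R[i]]_N) c d : R[i] :=
  ((map_mx conjc d)^T *m A *m c) ord0 ord0.

Definition surrogate_solution (Kt Mt : 'M[R[i]]_N) k f g c :=
  Kt *m c - (k ^+ 2)%:C%C *: (Mt *m c) - (k%:C%C * 'i%C) *: (bmass *m c) = load_vector f g.

Definition galerkin_solution k f g c :=
  forall d, helmholtz T k (comb c) (comb d) = load T f g (comb d).

End discretization.

Section grids.
Context {R : realType} {n : nat}.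

(* [cell] is a grid of length [h] on [Oh]; lengths are measured in the maximum
   norm, for which a cube of edge length [h] has diameter [h]. *)
Definition is_grid (Oh : set 'rV[R]_n) (h : R) M (cell : 'I_M -> set 'rV[R]_n) :=
  [/\ forall t, open (cell t) /\ cell t `<=` Oh,
      trivIset setT cell,
      {ae leb R n, forall x, Oh x -> exists t, cell t x} &
      supremums [set r | exists t x y, [/\ cell t x, cell t y & r = `|x - y|]] h].

(* The grid lives on the reference domain [Oh] and "order p" is degree at most
   [p] in each variable there, as for mapped B-splines and tensor-product finite
   elements. *)
Definition order_basis (Oh Om : set 'rV[R]_n) (geo : 'rV[R]_n -> 'rV[R]_n)
    (p : nat) (h : R) N (phi : 'I_N -> sobolev Om 1) :=
  lin_indep phi /\
  exists M (cell : 'I_M -> set 'rV[R]_n), is_grid Oh h cell /\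
    forall i t, exists c : {ffun 'I_n -> 'I_p.+1} -> R[i],
      {ae leb R n, forall x, cell t x ->
        fn (phi i) (geo x) = \sum_al c al * (\prod_j x ord0 j ^+ al j)%:C%C}.

End grids.

(* The known theory that is recalled for one wave number [k] and one discrete
   space, with the common constant [C]. *)
Section theory.
Context {R : realType} {n : nat} {Om : set 'rV[R]_n} (T : trace_operator Om).

Let L2 := sq_integrable (leb R n) Om.
Let L2b := sq_integrable (surf R n) (boundary Om).
Let nL2 := norm2 (leb R n) Om.
Let nL2b := norm2 (surf R n) (boundary Om).

Record helmholtz_theory (C k : R) (p : nat) (h : R) N (phi : 'I_N -> sobolev Om 1) : Prop :=
  HelmholtzTheory {
  continuous_wellposed : forall f g, L2 f -> L2b g ->
    exists2 u, weak_solution T k f g u &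
      forall u', weak_solution T k f g u' -> eq_ae (leb R n) Om (fn u') (fn u);
  discrete_wellposed : forall f g, L2 f -> L2b g ->
    exists! c, galerkin_solution T phi k f g c;
  continuous_stability : forall f g u, L2 f -> L2b g -> weak_solution T k f g u ->
    energy_norm k u <= C * (nL2 f + nL2b g);
  continuous_stability_H1 : forall (f : sobolev Om 1) u,
    weak_solution T k (fn f) (fun=> 0) u ->
    energy_norm k u <= C * (k^-1 * sobolev_norm f);
  discrete_error : forall (f : sobolev Om p.-1) g u c, trace_space T p g ->
    weak_solution T k (fn f) g u -> galerkin_solution T phi k (fn f) g c ->
    energy_norm k (u - comb phi c) <=
      C * ((h * k) ^+ p * (sobolev_norm f + trace_norm T p g));
  discrete_error_homogeneous : forall (f : sobolev Om p.-1) u c,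
    weak_solution T k (fn f) (fun=> 0) u ->
    galerkin_solution T phi k (fn f) (fun=> 0) c ->
    energy_norm k (u - comb phi c) <= C * ((h * k) ^+ p * k^-1 * sobolev_norm f);
  discrete_stability : forall f g u c, L2 f -> L2b g ->
    weak_solution T k f g u -> galerkin_solution T phi k f g c ->
    energy_norm k (comb phi c) <= C * energy_norm k u }.

(* [cp], [ch] are suitable for a class [V] of discrete spaces, where [V h phi]
   says that [phi] is the basis of a space of the class with grid length [h]:
   under the two resolution conditions the theory holds with a constant that is
   uniform in the wave number and in the space. *)
Definition suitable_constants (k0 k1 : R) (p : nat)
    (V : forall (h : R) (N : nat), ('I_N -> sobolev Om 1) -> Prop) (cp ch : R) :=
  cp * ln k1 <= p%:R ->
  exists2 C : R, 0 < C & forall k h N (phi : 'I_N -> sobolev Om 1),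
    k0 <= k -> k <= k1 -> h <= ch * (ln k1 / k1) -> V h N phi ->
    helmholtz_theory C k p h phi.

End theory.

Section sampling.
Context {R : realType} {n : nat}.

Definition stencil_coord (p : nat) (h : R) (l : nat) : R := (l%:R - p.+1%:R / 2) * h.

Definition stencil_grid (p m : nat) (h : R) : set 'rV[R]_n :=
  [set x | forall d, exists2 l, (p.+1 <= l <= m - p)%N & x ord0 d = stencil_coord p h l].

Implicit Types (Xi : 'I_n -> seq R) (i j : {ffun 'I_n -> nat}).

Definition knot_index Xi i : Prop := forall d, (i d < size (Xi d))%N.

Definition knot Xi i : 'rV[R]_n := \row_d nth 0 (Xi d) (i d).

(* The set is finite, so that the supremum is a maximum. *)
Definition sampling_length Xi : R :=
  sup [set r | exists i j, [/\ (\sum_d j d)%N = 1%N, knot_index Xi i,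
    knot_index Xi [ffun d => (i d + j d)%N] &
    r = `|knot Xi [ffun d => (i d + j d)%N] - knot Xi i| ]].

(* Repeated knots are allowed, so only the nonzero spans are compared. *)
Definition quasi_uniform (theta : R) Xi :=
  (forall d, sorted <=%R (Xi d)) /\
  forall d l d' l', (l.+1 < size (Xi d))%N -> (l'.+1 < size (Xi d'))%N ->
    let span c t := nth 0 (Xi c) t.+1 - nth 0 (Xi c) t in
    0 < span d l -> span d' l' <= theta * span d l.

Definition sampling_knots (p m : nat) (h theta : R) Xi :=
  quasi_uniform theta Xi /\
  exists2 Xs, Xs `<=` stencil_grid p m h & forall i, knot_index Xi i -> Xs (knot Xi i).

End sampling.

(* Main.v *)
Require Import Defs.
From mathcomp Require Import all_boot all_order all_algebra.
From mathcomp Require Import all_classical all_reals all_analysis.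
From mathcomp Require Import complex measurable_realfun ring lra.

Set Implicit Arguments.
Unset Strict Implicit.
Unset Printing Implicit Defensive.

Import Order.TTheory GRing.Theory Num.Theory.
Import numFieldNormedType.Exports.
Import Normc.

Local Open Scope classical_set_scope.
Local Open Scope ring_scope.

(** The surrogate system is a small perturbation of the discrete Helmholtz system,
    so the theorem follows from a Strang argument as soon as the discrete operator
    is stable from the dual of the energy space: a residual functional bounded by
    [eps] times the energy norm must come from a discrete function whose energy
    norm is at most [S * eps], with [S] the same for all spaces and wave numbers
    of the class.

    The recalled theory gives stability only for data in L2.  [discrete_inf_sup]
    bridges the gap.  Adding [2 * k ^+ 2] times the mass form turns the Helmholtz
    form into one whose real part on the diagonal is the squared energy norm; the
    boundary form contributes only to the imaginary part.  Solving with this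
    coercive form first leaves a remainder whose datum is [2 * k ^+ 2] times a
    discrete function [c0].  That datum lies in L2, and its L2 norm is at most
    [2 * k] times the energy norm of [c0], whence [S = 1 + 2 * C ^+ 2 * k1].

    The two consistency assumptions bound the perturbation by
    [K * H ^+ (minn q1 q2).+1] in the energy norm ([surrogate_close]).  Once
    [S * K * H <= 1 / 2], the perturbed matrix is injective
    ([perturbed_unitmx]), and the surrogate and Galerkin solutions differ by at
    most [2 * S * K * H ^+ (minn q1 q2).+1] times the energy norm of the latter
    ([perturbation_error]).  Discrete stability bounds that norm by the one of the
    exact solution, hence by the data; the triangle inequality and the Galerkin
    error estimate conclude.  The case of a vanishing boundary datum differs only
    in the sharper recalled estimates that are inserted. *)

(** * The square integrable functions as a pre-Hilbert space *)

Section square_integrable.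
Context d (T : measurableType d) (R : realType) (mu : {measure set T -> \bar R}).
Context (D : set T).
Implicit Types f g w : T -> R[i].

Definition cdot f g : R[i] := cint mu D (fun x => f x * conjc (g x)).

Lemma sqr_normc_Re_Im (z : R[i]) :
  normc z ^+ 2 = complex.Re z ^+ 2 + complex.Im z ^+ 2.
Proof. by case: z => x y /=; rewrite sqr_sqrtr// addr_ge0 ?sqr_ge0. Qed.

Lemma cintegrable_cdot f g : sq_integrable mu D f -> sq_integrable mu D g ->
  cintegrable mu D (fun x => f x * conjc (g x)).
Proof.
move=> [fR fI fi] [gR gI gi].
have ifg : mu.-integrable setT (fun x => ((fun x => normc (f x) ^+ 2) \_ D x)%:E
    + ((fun x => normc (g x) ^+ 2) \_ D x)%:E)%E by exact: integrableD.
split; apply: (le_integrable _ _ _ ifg) => //.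
- apply/measurable_EFinP.
  rewrite (_ : _ \_ D = fun x =>
      ((fun x => complex.Re (f x)) \_ D) x * ((fun x => complex.Re (g x)) \_ D) x
    + ((fun x => complex.Im (f x)) \_ D) x * ((fun x => complex.Im (g x)) \_ D) x).
    by apply: measurable_funD; exact: measurable_funM.
  apply/funext => x; rewrite /patch; case: ifP => _; last by rewrite !mulr0 addr0.
  by case: (f x) (g x) => [a b] [a' b'] /=; ring.
- move=> x _ /=; rewrite lee_fin /patch; case: ifP => _; last by rewrite normr0.
  rewrite [leRHS]ger0_norm ?addr_ge0 ?sqr_ge0// !sqr_normc_Re_Im.
  case: (f x) (g x) => [a b] [a' b'] /=.
  have := sqr_ge0 (a + a'); have := sqr_ge0 (a - a').
  have := sqr_ge0 (b + b'); have := sqr_ge0 (b - b').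
  have := sqr_ge0 a; have := sqr_ge0 a'; have := sqr_ge0 b; have := sqr_ge0 b'.
  by rewrite ler_norml; nra.
- apply/measurable_EFinP.
  rewrite (_ : _ \_ D = fun x =>
      ((fun x => complex.Im (f x)) \_ D) x * ((fun x => complex.Re (g x)) \_ D) x
    - ((fun x => complex.Re (f x)) \_ D) x * ((fun x => complex.Im (g x)) \_ D) x).
    by apply: measurable_funB; exact: measurable_funM.
  apply/funext => x; rewrite /patch; case: ifP => _; last by rewrite !mulr0 subr0.
  by case: (f x) (g x) => [a b] [a' b'] /=; ring.
- move=> x _ /=; rewrite lee_fin /patch; case: ifP => _; last by rewrite normr0.
  rewrite [leRHS]ger0_norm ?addr_ge0 ?sqr_ge0// !sqr_normc_Re_Im.
  case: (f x) (g x) => [a b] [a' b'] /=.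
  have := sqr_ge0 (a + b'); have := sqr_ge0 (a - b').
  have := sqr_ge0 (b + a'); have := sqr_ge0 (b - a').
  have := sqr_ge0 a; have := sqr_ge0 a'; have := sqr_ge0 b; have := sqr_ge0 b'.
  by rewrite ler_norml; nra.
Qed.

Lemma cdotZDl (a : R[i]) f g w :
  sq_integrable mu D f -> sq_integrable mu D g -> sq_integrable mu D w ->
  cdot (fun x => a * f x + g x) w = a * cdot f w + cdot g w.
Proof.
move=> f2 g2 w2; rewrite /cdot -cintZD; try exact: cintegrable_cdot.
by congr (cint _ _ _); apply/funext => x; ring.
Qed.

Lemma cdotZDr (a : R[i]) f g w :
  sq_integrable mu D f -> sq_integrable mu D g -> sq_integrable mu D w ->
  cdot w (fun x => a * f x + g x) = conjc a * cdot w f + cdot w g.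
Proof.
move=> f2 g2 w2; rewrite /cdot -cintZD; try exact: cintegrable_cdot.
by congr (cint _ _ _); apply/funext => x; rewrite rmorphD rmorphM/=; ring.
Qed.

Lemma cdot_norm2 f : cdot f f = (norm2 mu D f ^+ 2)%:C%C.
Proof.
rewrite /cdot /norm2 sqr_sqrtr; last first.
  by apply: Rintegral_ge0 => x _; exact: sqr_ge0.
rewrite /cint; congr Complex.
  apply: eq_Rintegral => x _; rewrite sqr_normc_Re_Im.
  by case: (f x) => a b /=; ring.
under eq_Rintegral => x _.
  rewrite (_ : complex.Im _ = 0); last by case: (f x) => a b /=; ring.
  over.
by rewrite /Rintegral integral0.
Qed.

Lemma cdot0l f : cdot (fun=> 0) f = 0.
Proof.
rewrite /cdot (_ : (fun _ => _) = fun=> 0); last by apply/funext => x; rewrite mul0r.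
by rewrite /cint /Rintegral integral0.
Qed.

Lemma eq_ae_refl f : eq_ae mu D f f.
Proof. exact/aeW. Qed.

Lemma eq_ae_sym f g : eq_ae mu D f g -> eq_ae mu D g f.
Proof. by apply: filterS => x fg /fg. Qed.

Let cint_ae f g : cintegrable mu D f -> cintegrable mu D g -> eq_ae mu D f g ->
  cint mu D f = cint mu D g.
Proof.
move=> [fR fI] [gR gI] fg.
rewrite /cint !(Rintegral_mkcond mu D) /Rintegral; congr (Complex (fine _) (fine _));
  (apply: ae_eq_integral; [exact: measurableT|by apply: (measurable_int mu)|
                           by apply: (measurable_int mu)|]);
  by apply: filterS fg => x fg _ /=; rewrite /patch; case: ifPn => // /set_mem/fg ->.
Qed.

Lemma cdot_ae f f' g g' :
  sq_integrable mu D f -> sq_integrable mu D f' ->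
  sq_integrable mu D g -> sq_integrable mu D g' ->
  eq_ae mu D f f' -> eq_ae mu D g g' -> cdot f g = cdot f' g'.
Proof.
move=> f2 f'2 g2 g'2 ff gg; apply: cint_ae; try exact: cintegrable_cdot.
by apply: filterS2 ff gg => x ff gg Dx; rewrite ff// gg.
Qed.

Lemma norm2_eq0 f : sq_integrable mu D f -> norm2 mu D f = 0 -> eq_ae mu D f (fun=> 0).
Proof.
move=> [fR fI fi] /eqP; rewrite sqrtr_eq0 => le0.
have F0 x : 0 <= ((fun x => normc (f x) ^+ 2) \_ D) x.
  by rewrite /patch; case: ifP => // _; exact: sqr_ge0.
have : ae_eq mu setT (EFin \o ((fun x => normc (f x) ^+ 2) \_ D)) (cst 0%E).
  apply/ae_eq_integral_abs => //; first exact: (measurable_int mu fi).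
  under eq_integral do rewrite /= ger0_norm//.
  move: le0; rewrite Rintegral_mkcond => le0.
  have fin := integrable_fin_num measurableT fi.
  apply/eqP; rewrite eq_le integral_ge0 ?andbT; last by move=> x _; rewrite lee_fin.
  by rewrite -(fineK fin) lee_fin.
apply: filterS => x /(_ I) /= + Dx; rewrite /patch mem_set// => -[] /eqP.
by rewrite sqrf_eq0 => /eqP/eq0_normc.
Qed.

(** A boundary datum is prescribed only up to equality almost everywhere with a
    trace; completeness of the measure transfers measurability to it. *)
Lemma sq_integrable_ae f g : measure_is_complete mu ->
  sq_integrable mu D f -> eq_ae mu D f g -> sq_integrable mu D g.
Proof.
move=> cmu [fR fI fi] fg.
have aefg (h : R[i] -> R) : ae_eq mu setT (EFin \o ((fun x => h (f x)) \_ D))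
    (EFin \o ((fun x => h (g x)) \_ D)).
  by apply: filterS fg => x fg _ /=; rewrite /patch; case: ifPn => // /set_mem/fg ->.
have mg (h : R[i] -> R) : measurable_fun setT ((fun x => h (f x)) \_ D) ->
    measurable_fun setT ((fun x => h (g x)) \_ D).
  move=> mf; apply/measurable_EFinP.
  by apply: (ae_measurable_fun cmu (aefg h)); exact/measurable_EFinP.
split; [exact: mg|exact: mg|].
have mN := measurable_int mu fi.
apply/integrableP; split.
  exact: (ae_measurable_fun cmu (aefg (fun z => normc z ^+ 2)) mN).
have /integrableP[_] := fi.
rewrite (@ae_eq_integral _ _ _ _ _ (abse \o (EFin \o (fun x => normc (g x) ^+ 2) \_ D)))//.
- exact: measurableT_comp.
- by apply: measurableT_comp => //; exact: (ae_measurable_fun cmu (aefg (fun z => normc z ^+ 2)) mN).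
- apply: filterS (aefg (fun z => normc z ^+ 2)) => x /(_ I) /= e _; by case: e => ->.
Qed.

End square_integrable.

(** * Sesquilinear forms *)

Section sesquilinear_forms.
Context (R : rcfType) (V : lmodType R[i]).
Implicit Types (s : V -> V -> R[i]) (u v w : V).

Definition sesquilinear s :=
  (forall w (c : R[i]) u v, s (c *: u + v) w = c * s u w + s v w) /\
  (forall w (c : R[i]) u v, s w (c *: u + v) = conjc c * s w u + s w v).

Lemma sesquilinearZD (a : R[i]) s s' : sesquilinear s -> sesquilinear s' ->
  sesquilinear (fun u v => a * s u v + s' u v).
Proof.
by move=> [sl sr] [sl' sr']; split=> *; rewrite ?sl ?sl' ?sr ?sr'; ring.
Qed.

Lemma sesquilinear_sum (I : Type) (r : seq I) (s : I -> V -> V -> R[i]) :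
  (forall i, sesquilinear (s i)) -> sesquilinear (fun u v => \sum_(i <- r) s i u v).
Proof.
move=> ss; split=> w c u v; rewrite mulr_sumr -big_split; apply: eq_bigr => i _.
  by have [-> _] := ss i.
by have [_ ->] := ss i.
Qed.

Lemma sesquilinearZ s (c : R[i]) u : sesquilinear s ->
  s (c *: u) (c *: u) = c * conjc c * s u u.
Proof.
move=> [sl sr].
have s0 v : s 0 v = 0.
  by apply: (@addIr _ (s 0 v)); rewrite add0r -{1}(mul1r (s 0 v)) -sl scale1r addr0.
have s0' v : s v 0 = 0.
  apply: (@addIr _ (s v 0)).
  by rewrite add0r -{1}(mul1r (s v 0)) -conjc1 -sr scale1r addr0.
by rewrite -[c *: u]addr0 sl !sr !s0 !s0' mulr0 !addr0 mulrA.
Qed.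

(** For real [t] the square [E (u + t *: v) ^+ 2] is a quadratic polynomial in [t]
    without sign changes, so that its discriminant bounds the mixed term. *)
Lemma triangle_of_sesquilinear s (E : V -> R) : sesquilinear s ->
  (forall u, 0 <= E u) -> (forall u, complex.Re (s u u) = E u ^+ 2) ->
  forall u v, E (u + v) <= E u + E v.
Proof.
move=> [sl sr] E0 sE u v.
pose b := complex.Re (s v u) + complex.Re (s u v).
have expand (t : R) : E (t%:C%C *: v + u) ^+ 2 = t ^+ 2 * E v ^+ 2 + t * b + E u ^+ 2.
  rewrite -!sE /b sl !sr.
  case: (s v v) (s v u) (s u v) (s u u) => [? ?] [? ?] [? ?] [? ?] /=.
  by ring.
have bE : b <= 2 * (E u * E v).
  have [b0|b0] := leP b 0; first by apply: le_trans b0 _; rewrite !mulr_ge0.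
  have [Ev0|Evn0] := eqVneq (E v) 0.
    have := sqr_ge0 (E ((- (E u ^+ 2 + 1) / b)%:C%C *: v + u)).
    rewrite expand Ev0 expr0n mulr0 add0r divfK ?gt_eqF//.
    by rewrite opprD addrAC addNr add0r ler0N1.
  have Ev_gt0 : 0 < E v by rewrite lt_neqAle eq_sym Evn0 E0.
  rewrite -(@ler_pXn2r _ 2) ?nnegrE ?(ltW b0) ?mulr_ge0 ?E0 ?ler0n// -subr_ge0.
  (* the polynomial at its minimiser *)
  have := sqr_ge0 (E ((- (b / (2 * E v ^+ 2)))%:C%C *: v + u)); rewrite expand.
  have -> : (- (b / (2 * E v ^+ 2))) ^+ 2 * E v ^+ 2 + - (b / (2 * E v ^+ 2)) * b
      + E u ^+ 2 = ((2 * (E u * E v)) ^+ 2 - b ^+ 2) / (2 * E v) ^+ 2 by field.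
  by rewrite pmulr_lge0// invr_gt0 exprn_gt0// mulr_gt0.
rewrite -(@ler_pXn2r _ 2) ?nnegrE ?addr_ge0//.
have -> : u + v = 1%:C%C *: v + u by rewrite scale1r addrC.
by rewrite expand; move: bE; nra.
Qed.

Lemma normN_of_sesquilinear s (E : V -> R) : sesquilinear s ->
  (forall u, 0 <= E u) -> (forall u, complex.Re (s u u) = E u ^+ 2) ->
  forall u, E (- u) = E u.
Proof.
move=> ss E0 sE u; apply/eqP; rewrite -(@eqrXn2 _ 2) ?E0// -!sE -scaleN1r.
by rewrite (sesquilinearZ _ _ ss) rmorphN rmorph1 mulrNN !mul1r.
Qed.

End sesquilinear_forms.

Section helmholtz_forms.
Context {R : realType} {n : nat} {Om : set 'rV[R]_n}.
Implicit Types u v w : sobolev Om 1.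

Lemma fn_sq_integrable m (u : sobolev Om m) : sq_integrable (leb R n) Om (fn u).
Proof.
have /asboolP/(_ [ffun=> 0%N])[]// := sobolevP u.
by rewrite /morder big1// => i _; rewrite ffunE.
Qed.

Lemma grad_sq_integrable u i : sq_integrable (leb R n) Om (grad u i).
Proof.
have /asboolP/(_ [ffun j => nat_of_bool (j == i)])[]// := sobolevP u.
rewrite /morder (bigD1 i)//= ffunE eqxx big1 ?addn0// => j /negbTE ji.
by rewrite ffunE ji.
Qed.

Lemma fnZD (c : R[i]) u v : fn (c *: u + v) = fun x => c * fn u x + fn v x.
Proof. by []. Qed.

Lemma gradZD (c : R[i]) u v i :
  grad (c *: u + v) i = fun x => c * grad u i x + grad v i x.
Proof. by []. Qed.

Lemma fn0 : fn (0 : sobolev Om 1) = fun=> 0.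
Proof. by []. Qed.

Lemma form_m_sesquilinear : sesquilinear (@form_m R n Om).
Proof.
by split=> w c u v; rewrite /form_m ?fnZD; [apply: cdotZDl|apply: cdotZDr];
  exact: fn_sq_integrable.
Qed.

Lemma form_aE u v :
  form_a u v = \sum_(i < n) cdot (leb R n) Om (grad u i) (grad v i).
Proof.
rewrite /form_a.
suff [_ ->//] : cintegrable (leb R n) Om
    (fun x => \sum_(i <- index_enum 'I_n) grad u i x * conjc (grad v i x)) /\
  cint (leb R n) Om (fun x => \sum_(i <- index_enum 'I_n) grad u i x * conjc (grad v i x)) =
  \sum_(i <- index_enum 'I_n) cdot (leb R n) Om (grad u i) (grad v i).
elim: (index_enum _) => [|i r [ir IH]].
  rewrite big_nil (_ : (fun _ => _) = fun x => 0 * conjc 0); last first.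
    by apply/funext => x; rewrite big_nil mul0r.
  split; last exact: cdot0l.
  exact: (cintegrable_cdot (sq_integrable0 _ _) (sq_integrable0 _ _)).
have ii := cintegrable_cdot (grad_sq_integrable u i) (grad_sq_integrable v i).
rewrite big_cons (_ : (fun _ => _) = fun x => 1 * (grad u i x * conjc (grad v i x)) +
  \sum_(j <- r) grad u j x * conjc (grad v j x)); last first.
  by apply/funext => x; rewrite big_cons mul1r.
by split; [exact: cintegrableZD|rewrite cintZD// IH mul1r].
Qed.

Lemma form_a_sesquilinear : sesquilinear (@form_a R n Om).
Proof.
have -> : @form_a R n Om =
    fun u v => \sum_(i < n) cdot (leb R n) Om (grad u i) (grad v i).
  by apply/funext => u; apply/funext => v; exact: form_aE.
apply: sesquilinear_sum => i.
by split=> w c u v; rewrite ?gradZD; [apply: cdotZDl|apply: cdotZDr];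
  exact: grad_sq_integrable.
Qed.

Lemma form_m_norm2 u : form_m u u = (norm2 (leb R n) Om (fn u) ^+ 2)%:C%C.
Proof. exact: cdot_norm2. Qed.

Lemma form_a_grad_norm u : form_a u u = (grad_norm u ^+ 2)%:C%C.
Proof.
rewrite form_aE /grad_norm sqr_sqrtr; last by apply: sumr_ge0 => i _; exact: sqr_ge0.
by rewrite rmorph_sum; apply: eq_bigr => i _; exact: cdot_norm2.
Qed.

Lemma energy_norm_ge0 (k : R) u : 0 <= energy_norm k u.
Proof. exact: sqrtr_ge0. Qed.

Lemma sqr_energy_norm (k : R) u :
  energy_norm k u ^+ 2 = grad_norm u ^+ 2 + k ^+ 2 * norm2 (leb R n) Om (fn u) ^+ 2.
Proof.
rewrite [in LHS]/energy_norm sqr_sqrtr//.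
by apply: addr_ge0; [exact: sqr_ge0|apply: mulr_ge0; exact: sqr_ge0].
Qed.

Let energy_sesquilinear (k : R) :=
  sesquilinearZD (k ^+ 2)%:C%C form_m_sesquilinear form_a_sesquilinear.

Let energy_form_diag (k : R) u :
  complex.Re ((k ^+ 2)%:C%C * form_m u u + form_a u u) = energy_norm k u ^+ 2.
Proof.
by rewrite form_m_norm2 form_a_grad_norm sqr_energy_norm/= mul0r subr0 addrC.
Qed.

Lemma energy_norm_triangle (k : R) u v :
  energy_norm k (u + v) <= energy_norm k u + energy_norm k v.
Proof.
exact: (triangle_of_sesquilinear (energy_sesquilinear k)
  (energy_norm_ge0 k) (energy_form_diag k)).
Qed.

Lemma energy_normN (k : R) u : energy_norm k (- u) = energy_norm k u.
Proof.
exact: (normN_of_sesquilinear (energy_sesquilinear k)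
  (energy_norm_ge0 k) (energy_form_diag k)).
Qed.

Lemma le_energy_norm (k : R) u : 0 <= k ->
  k * norm2 (leb R n) Om (fn u) <= energy_norm k u.
Proof.
move=> k0; rewrite -(@ler_pXn2r _ 2) ?nnegrE ?energy_norm_ge0 ?mulr_ge0 ?sqrtr_ge0//.
by rewrite sqr_energy_norm exprMn lerDr sqr_ge0.
Qed.

End helmholtz_forms.

Section impedance_forms.
Context {R : realType} {n : nat} {Om : set 'rV[R]_n} (T : trace_operator Om).
Implicit Types (f g : 'rV[R]_n -> R[i]) (u v w : sobolev Om 1).

Lemma surf_complete : measure_is_complete (surf R n).
Proof. exact: measure_is_complete_caratheodory. Qed.

Lemma cdot_trZDr f (c : R[i]) u v : sq_integrable (surf R n) (boundary Om) f ->
  cdot (surf R n) (boundary Om) f (T (c *: u + v)) =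
  conjc c * cdot (surf R n) (boundary Om) f (T u) + cdot (surf R n) (boundary Om) f (T v).
Proof.
move=> f2; apply: etrans (cdotZDr c (tr_sq_integrable T u) (tr_sq_integrable T v) f2).
exact: (cdot_ae f2 f2 (tr_sq_integrable T (c *: u + v))
  (sq_integrableZD c (tr_sq_integrable T u) (tr_sq_integrable T v))
  (eq_ae_refl _ _ _) (tr_linear T c u v)).
Qed.

Lemma form_b_sesquilinear : sesquilinear (form_b T).
Proof.
split=> w c u v; last by apply: cdot_trZDr; exact: tr_sq_integrable.
apply: etrans (cdotZDl c (tr_sq_integrable T u) (tr_sq_integrable T v)
  (tr_sq_integrable T w)).
exact: (cdot_ae (tr_sq_integrable T (c *: u + v))
  (sq_integrableZD c (tr_sq_integrable T u) (tr_sq_integrable T v))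
  (tr_sq_integrable T w) (tr_sq_integrable T w)
  (tr_linear T c u v) (eq_ae_refl _ _ _)).
Qed.

Lemma loadZD f g (c : R[i]) u v : sq_integrable (leb R n) Om f ->
  sq_integrable (surf R n) (boundary Om) g ->
  load T f g (c *: u + v) = conjc c * load T f g u + load T f g v.
Proof.
move=> f2 g2; have E1 := cdotZDr c (fn_sq_integrable u) (fn_sq_integrable v) f2.
have E2 := cdot_trZDr c u v g2; transitivity
  (cdot (leb R n) Om f (fn (c *: u + v)) +
   cdot (surf R n) (boundary Om) g (T (c *: u + v))); first by [].
by rewrite E2 E1 mulrDr addrACA.
Qed.

Lemma load_ae f f' g g' v :
  sq_integrable (leb R n) Om f -> sq_integrable (leb R n) Om f' ->
  sq_integrable (surf R n) (boundary Om) g ->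
  sq_integrable (surf R n) (boundary Om) g' ->
  eq_ae (leb R n) Om f f' -> eq_ae (surf R n) (boundary Om) g g' ->
  load T f g v = load T f' g' v.
Proof.
move=> f2 f'2 g2 g'2 ff gg; rewrite /load; congr (_ + _).
  exact: (cdot_ae f2 f'2 (fn_sq_integrable v) (fn_sq_integrable v) ff (eq_ae_refl _ _ _)).
exact: (cdot_ae g2 g'2 (tr_sq_integrable T v) (tr_sq_integrable T v) gg (eq_ae_refl _ _ _)).
Qed.

Lemma trace_space_sq_integrable s g : trace_space T s g ->
  sq_integrable (surf R n) (boundary Om) g.
Proof.
move=> [G [U _ Ug]].
exact: sq_integrable_ae surf_complete (tr_sq_integrable T U) Ug.
Qed.

End impedance_forms.

(** * Coefficient vectors *)

Section coefficients.
Context {R : realType} {N : nat}.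
Implicit Types (c d x : 'cV[R[i]]_N) (A : 'M[R[i]]_N).

Definition pairing d x : R[i] := ((map_mx conjc d)^T *m x) ord0 ord0.

Lemma pairingE d x : pairing d x = \sum_j conjc (d j ord0) * x j ord0.
Proof. by rewrite /pairing mxE; apply: eq_bigr => j _; rewrite !mxE. Qed.

Lemma pairingZ (a : R[i]) d x : pairing d (a *: x) = a * pairing d x.
Proof. by rewrite /pairing -scalemxAr mxE. Qed.

Lemma pairingB d x y : pairing d (x - y) = pairing d x - pairing d y.
Proof. by rewrite /pairing mulmxBr !mxE. Qed.

Lemma pairing_inj x y : (forall d, pairing d x = pairing d y) -> x = y.
Proof.
move=> xy; apply/colP => i; have := xy (delta_mx i ord0); rewrite !pairingE.
rewrite (bigD1 i)//= [RHS](bigD1 i)//= !mxE !eqxx conjc1 !mul1r.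
by rewrite !big1 ?addr0// => j /negbTE ji; rewrite mxE ji conjc0 mul0r.
Qed.

Lemma matrix_formE A c d : matrix_form A c d = pairing d (A *m c).
Proof. by rewrite /matrix_form -mulmxA. Qed.

Lemma unitmx_of_injective A : (forall c, A *m c = 0 -> c = 0) -> A \in unitmx.
Proof.
move=> Ainj; rewrite -unitmx_tr -row_free_unit; apply: inj_row_free => v vA.
by apply: trmx_inj; rewrite trmx0; apply: Ainj; rewrite -[A]trmxK -trmx_mul vA trmx0.
Qed.

End coefficients.

Section combinations.
Context {R : realType} {n : nat} {Om : set 'rV[R]_n} (T : trace_operator Om).
Context {N : nat} (phi : 'I_N -> sobolev Om 1).
Implicit Types (f g : 'rV[R]_n -> R[i]) (c d : 'cV[R[i]]_N).

Lemma combB c d : comb phi (c - d) = comb phi c - comb phi d.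
Proof.
by rewrite /comb -sumrB; apply: eq_bigr => i _; rewrite !mxE scalerBl.
Qed.

Lemma combN c : comb phi (- c) = - comb phi c.
Proof. by rewrite /comb -sumrN; apply: eq_bigr => i _; rewrite !mxE scaleNr. Qed.

Lemma combD c d : comb phi (c + d) = comb phi c + comb phi d.
Proof. by rewrite -[d in LHS]opprK combB combN opprK. Qed.

Lemma semilinear_comb (F : sobolev Om 1 -> R[i]) (sigma : R[i] -> R[i]) :
  sigma 1 = 1 -> (forall a u v, F (a *: u + v) = sigma a * F u + F v) ->
  forall c, F (comb phi c) = \sum_i sigma (c i ord0) * F (phi i).
Proof.
move=> s1 FZD c; rewrite /comb; elim/big_rec2: _ => [|i a u _ <-]; last by rewrite FZD.
have := FZD 1 0 0; rewrite scale1r addr0 s1 mul1r => E.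
by apply: (@addIr _ (F 0)); rewrite add0r -E.
Qed.

Lemma sesquilinear_comb s c d : sesquilinear s ->
  s (comb phi c) (comb phi d) = pairing d ((\matrix_(i, j) s (phi j) (phi i)) *m c).
Proof.
move=> [sl sr]; rewrite (semilinear_comb (conjc1 _) (sr _)) pairingE.
apply: eq_bigr => i _; rewrite mxE (@semilinear_comb (s^~ _) id)//.
by congr (_ * _); apply: eq_bigr => j _; rewrite !mxE mulrC.
Qed.

Lemma load_comb f g d : sq_integrable (leb R n) Om f ->
  sq_integrable (surf R n) (boundary Om) g ->
  load T f g (comb phi d) = pairing d (load_vector T phi f g).
Proof.
move=> f2 g2; rewrite (semilinear_comb (conjc1 _)); last by move=> *; exact: loadZD.
by rewrite pairingE; apply: eq_bigr => i _; rewrite mxE.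
Qed.

Definition helmholtz_matrix (K M : 'M[R[i]]_N) (k : R) : 'M[R[i]]_N :=
  K - (k ^+ 2)%:C%C *: M - (k%:C%C * 'i%C) *: bmass T phi.

Lemma pairing_helmholtz_matrix (K M : 'M[R[i]]_N) (k : R) c d :
  pairing d (helmholtz_matrix K M k *m c) =
  matrix_form K c d - (k ^+ 2)%:C%C * matrix_form M c d
  - k%:C%C * 'i%C * form_b T (comb phi c) (comb phi d).
Proof.
rewrite (sesquilinear_comb _ _ (form_b_sesquilinear T)) !matrix_formE.
rewrite !mulmxBl -!scalemxAl !pairingB.
by rewrite !pairingZ.
Qed.

Lemma helmholtz_comb (k : R) c d :
  helmholtz T k (comb phi c) (comb phi d) =
  pairing d (helmholtz_matrix (stiffness phi) (mass phi) k *m c).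
Proof.
rewrite pairing_helmholtz_matrix !matrix_formE /helmholtz.
by rewrite (sesquilinear_comb _ _ form_a_sesquilinear)
  (sesquilinear_comb _ _ form_m_sesquilinear).
Qed.

Lemma galerkin_solutionE (k : R) f g c : sq_integrable (leb R n) Om f ->
  sq_integrable (surf R n) (boundary Om) g -> galerkin_solution T phi k f g c ->
  helmholtz_matrix (stiffness phi) (mass phi) k *m c = load_vector T phi f g.
Proof.
by move=> f2 g2 gal; apply: pairing_inj => d; rewrite -load_comb// -gal helmholtz_comb.
Qed.

Lemma surrogate_solutionE (Kt Mt : 'M[R[i]]_N) (k : R) f g c :
  surrogate_solution T phi Kt Mt k f g c <->
  helmholtz_matrix Kt Mt k *m c = load_vector T phi f g.
Proof. by rewrite /surrogate_solution /helmholtz_matrix !mulmxBl -!scalemxAl. Qed.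

End combinations.

(** * Discrete inf-sup stability *)

Section inf_sup.
Context {R : realType} {n : nat} {Om : set 'rV[R]_n} (T : trace_operator Om).
Context {N : nat} (phi : 'I_N -> sobolev Om 1).

Lemma Re_le_normc (z : R[i]) : complex.Re z <= normc z.
Proof.
case: z => a b /=; apply: le_trans (ler_norm a) _.
by rewrite -sqrtr_sqr ler_wsqrtr// lerDl sqr_ge0.
Qed.

Lemma energy_norm_eq0 (k : R) c : 0 < k -> lin_indep phi ->
  energy_norm k (comb phi c) = 0 -> c = 0.
Proof.
move=> k0 li E0; apply: li; apply: norm2_eq0; first exact: fn_sq_integrable.
have := le_energy_norm (comb phi c) (ltW k0); rewrite E0 pmulr_rle0// => le0.
by apply/eqP; rewrite eq_le le0 sqrtr_ge0.
Qed.

(** With the sign of the zeroth-order term reversed the sesquilinear form becomes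
    coercive, whatever the wave number. *)
Definition shifted (k : R) (u v : sobolev Om 1) : R[i] :=
  (2 * k ^+ 2)%:C%C * form_m u v + helmholtz T k u v.

Lemma helmholtz_sesquilinear (k : R) : sesquilinear (helmholtz T k).
Proof.
have [al ar] := @form_a_sesquilinear R n Om; have [ml mr] := @form_m_sesquilinear R n Om.
have [bl br] := form_b_sesquilinear T.
by split=> w c u v; rewrite /helmholtz ?al ?ml ?bl ?ar ?mr ?br; ring.
Qed.

Lemma shifted_sesquilinear (k : R) : sesquilinear (shifted k).
Proof.
exact: sesquilinearZD form_m_sesquilinear (helmholtz_sesquilinear k).
Qed.

Lemma shifted_coercive (k : R) u : complex.Re (shifted k u u) = energy_norm k u ^+ 2.
Proof.
rewrite /shifted /helmholtz form_m_norm2 form_a_grad_norm sqr_energy_norm.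
rewrite /form_b -/(cdot (surf R n) (boundary Om) (T u) (T u)) cdot_norm2/=.
by ring.
Qed.

(** The residual functional of [comb phi c] splits into a part [c0] that the
    shifted form sees, controlled by coercivity, and a remainder [c - c0] that
    solves the discrete problem with the square integrable datum
    [2 * k ^+ 2 * c0]; the known stability for such data costs one factor [k].
    Data in the dual of the energy space thereby reduce to data in L2. *)
Lemma discrete_inf_sup (C k : R) (p : nat) (h : R) (c : 'cV[R[i]]_N) (eps : R) :
  0 < C -> 0 < k -> lin_indep phi -> helmholtz_theory T C k p h phi -> 0 <= eps ->
  (forall d, normc (helmholtz T k (comb phi c) (comb phi d)) <=
     eps * energy_norm k (comb phi d)) ->
  energy_norm k (comb phi c) <= (1 + 2 * C ^+ 2 * k) * eps.
Proof.
move=> C0 k0 li th eps0 res.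
pose P : 'M[R[i]]_N := \matrix_(i, j) shifted k (phi j) (phi i).
have shP c' d : shifted k (comb phi c') (comb phi d) = pairing d (P *m c').
  exact: sesquilinear_comb (shifted_sesquilinear k).
have Pu : P \in unitmx.
  apply: unitmx_of_injective => c' Pc'; apply: (energy_norm_eq0 k0 li).
  apply/eqP; rewrite -sqrf_eq0 -shifted_coercive shP Pc'.
  by rewrite /pairing mulmx0 mxE.
pose c0 := invmx P *m (helmholtz_matrix T phi (stiffness phi) (mass phi) k *m c).
have c0P d : shifted k (comb phi c0) (comb phi d) =
    helmholtz T k (comb phi c) (comb phi d).
  by rewrite shP mulKVmx// helmholtz_comb.
have Ec0 : energy_norm k (comb phi c0) <= eps.
  have [->//|En0] := eqVneq (energy_norm k (comb phi c0)) 0.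
  have E_gt0 : 0 < energy_norm k (comb phi c0).
    by rewrite lt_neqAle eq_sym En0 energy_norm_ge0.
  rewrite -(ler_pM2r E_gt0) -expr2 -shifted_coercive c0P.
  exact: le_trans (Re_le_normc _) (res c0).
set a : R[i] := (2 * k ^+ 2)%:C%C.
pose f : sobolev Om 1 := a *: comb phi c0.
(* the Helmholtz and the shifted form differ by the mass form, so that the parts
   seen by the residual cancel *)
have gal : galerkin_solution T phi k (fn f) (fun=> 0) (c - c0).
  move=> d; rewrite combB addrC -scaleN1r.
  have [-> _] := helmholtz_sesquilinear k; rewrite -c0P /shifted -/a mulN1r addrCA addNr addr0.
  have [ml _] := @form_m_sesquilinear R n Om.
  rewrite /load -/(cdot (surf R n) (boundary Om) (fun=> 0) (T (comb phi d))) cdot0l addr0.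
  have := ml (comb phi d) a (comb phi c0) 0; rewrite addr0.
  rewrite -/f /form_m => ->.
  by rewrite -/(cdot (leb R n) Om (fn 0) (fn (comb phi d))) fn0 cdot0l addr0.
have f2 := fn_sq_integrable f.
have z2 := sq_integrable0 (surf R n) (boundary Om).
have [u1 u1w _] := continuous_wellposed th f2 z2.
have st := continuous_stability th f2 z2 u1w.
have ds := discrete_stability th f2 z2 u1w gal.
have nz : norm2 (surf R n) (boundary Om) (fun=> 0) = 0.
  have := cdot_norm2 (surf R n) (boundary Om) (fun=> 0).
  by rewrite cdot0l => -[/esym/eqP]; rewrite sqrf_eq0 => /eqP.
have nf : norm2 (leb R n) Om (fn f) = 2 * k ^+ 2 * norm2 (leb R n) Om (fn (comb phi c0)).
  apply/eqP; rewrite -(@eqrXn2 _ 2) ?sqrtr_ge0 ?mulr_ge0 ?sqrtr_ge0 ?(ltW k0)//.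
  apply/eqP/complexI; rewrite -form_m_norm2 exprMn rmorphM/= -form_m_norm2.
  rewrite (sesquilinearZ _ _ form_m_sesquilinear); congr (_ * _).
  by rewrite /a conjc_real -rmorphM -expr2 exprMn.
have -> : comb phi c =
    comb phi (c - c0) + comb phi c0 by rewrite combB subrK.
apply: le_trans (energy_norm_triangle _ _ _) _.
rewrite mulrDl mul1r addrC; apply: lerD => //.
apply: le_trans ds _.
apply: (@le_trans _ _ (C * (C * (2 * k * (k * norm2 (leb R n) Om (fn (comb phi c0))))))).
  by rewrite ler_pM2l//; apply: le_trans st _; rewrite nz nf addr0 ler_pM2l//; lra.
have : k * norm2 (leb R n) Om (fn (comb phi c0)) <= eps.
  exact: le_trans (le_energy_norm _ (ltW k0)) Ec0.
move=> ke; rewrite (_ : C * _ = 2 * C ^+ 2 * k * (k * norm2 (leb R n) Om (fn (comb phi c0)))).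
  by rewrite ler_wpM2l// !mulr_ge0// ?ltW// exprn_ge0// ltW.
by ring.
Qed.

End inf_sup.

(** * Perturbation of a stable linear system *)

Section strang.
Context {R : realType} {N : nat}.
Variables (E : 'cV[R[i]]_N -> R) (A At : 'M[R[i]]_N) (S delta : R).
Hypothesis E_ge0 : forall c, 0 <= E c.
Hypothesis E_eq0 : forall c, E c = 0 -> c = 0.
Hypothesis E_triangle : forall c d, E (c + d) <= E c + E d.
Hypothesis S_ge0 : 0 <= S.
Hypothesis delta_ge0 : 0 <= delta.
Hypothesis stable : forall c eps, 0 <= eps ->
  (forall d, normc (pairing d (A *m c)) <= eps * E d) -> E c <= S * eps.
Hypothesis close : forall c d,
  normc (pairing d (A *m c - At *m c)) <= delta * E c * E d.
Hypothesis small : S * delta <= 2^-1.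

Lemma perturbed_unitmx : At \in unitmx.
Proof.
apply: unitmx_of_injective => c Atc; apply: E_eq0.
have : E c <= S * (delta * E c).
  apply: stable => [|d]; first exact: mulr_ge0.
  by have := close c d; rewrite Atc subr0.
by have := E_ge0 c; move: small; nra.
Qed.

(** The difference solves the unperturbed system with the perturbation of [ct]
    as right-hand side; smallness absorbs [ct] into [c]. *)
Lemma perturbation_error c ct : At *m ct = A *m c ->
  E (ct - c) <= 2 * (S * delta) * E c.
Proof.
move=> eqc.
have le1 : E (ct - c) <= S * (delta * E ct).
  apply: stable => [|d]; first exact: mulr_ge0.
  by have := close ct d; rewrite eqc mulmxBr.
have := E_triangle (ct - c) c; rewrite subrK => le2.
have := E_ge0 (ct - c); have := E_ge0 c; have := E_ge0 ct.
by have := mulr_ge0 S_ge0 delta_ge0; move: small; nra.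
Qed.

End strang.

(** * The surrogate system *)

Section surrogate.
Context {R : realType} {n : nat} {Om : set 'rV[R]_n} (T : trace_operator Om).
Context {N : nat} (phi : 'I_N -> sobolev Om 1).

Lemma le_grad_norm_energy_norm (k : R) (u : sobolev Om 1) :
  grad_norm u <= energy_norm k u.
Proof.
rewrite -(@ler_pXn2r _ 2) ?nnegrE ?energy_norm_ge0 ?sqrtr_ge0//.
by rewrite sqr_energy_norm lerDl -exprMn sqr_ge0.
Qed.

(** The mass perturbation carries the factor [k ^+ 2], which is split between the
    two arguments and absorbed by the energy norms. *)
Lemma surrogate_close (k H Ca Cm : R) (q1 q2 : nat) (Kt Mt : 'M[R[i]]_N) :
  0 < k -> 0 < H <= 1 ->
  (forall c d : 'cV[R[i]]_N,
    normc (form_a (comb phi c) (comb phi d) - matrix_form Kt c d) <=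
    Ca * (H ^+ q1.+1 * grad_norm (comb phi c) * grad_norm (comb phi d))) ->
  (forall c d : 'cV[R[i]]_N,
    normc (form_m (comb phi c) (comb phi d) - matrix_form Mt c d) <=
    Cm * (H ^+ q2.+1 * norm2 (leb R n) Om (fn (comb phi c))
                     * norm2 (leb R n) Om (fn (comb phi d)))) ->
  forall c d : 'cV[R[i]]_N,
    normc (pairing d (helmholtz_matrix T phi (stiffness phi) (mass phi) k *m c -
                      helmholtz_matrix T phi Kt Mt k *m c)) <=
    (`|Ca| + `|Cm|) * H ^+ (minn q1 q2).+1 *
      energy_norm k (comb phi c) * energy_norm k (comb phi d).
Proof.
move=> k0 /andP[H0 H1] ha hm c d.
set Ec := energy_norm k (comb phi c); set Ed := energy_norm k (comb phi d).
set Hq := H ^+ (minn q1 q2).+1.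
have Hle q : (minn q1 q2 <= q)%N -> H ^+ q.+1 <= Hq.
  by move=> lq; rewrite /Hq ler_wiXn2l// ltW.
have Hq0 : 0 <= Hq by rewrite exprn_ge0// ltW.
have E0 (C x y : R) (q : nat) : (minn q1 q2 <= q)%N -> 0 <= x <= Ec -> 0 <= y <= Ed ->
    C * (H ^+ q.+1 * x * y) <= `|C| * Hq * Ec * Ed.
  move=> lq /andP[x0 xE] /andP[y0 yE].
  have h0 : 0 <= H ^+ q.+1 by rewrite exprn_ge0// ltW.
  apply: (@le_trans _ _ (`|C| * (H ^+ q.+1 * x * y))).
    by rewrite ler_wpM2r ?ler_norm// !mulr_ge0.
  rewrite -!mulrA ler_wpM2l//; apply: ler_pM => //; [exact: mulr_ge0|exact: Hle|].
  exact: ler_pM.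
rewrite pairingB !pairing_helmholtz_matrix !matrix_formE.
rewrite -(sesquilinear_comb _ _ _ form_a_sesquilinear).
rewrite -(sesquilinear_comb _ _ _ form_m_sesquilinear) -!matrix_formE.
rewrite (_ : _ - _ = (form_a (comb phi c) (comb phi d) - matrix_form Kt c d) +
  - ((k ^+ 2)%:C%C * (form_m (comb phi c) (comb phi d) - matrix_form Mt c d))); last by ring.
apply: le_trans (le_normcD _ _) _; rewrite normcN normcM.
rewrite !mulrDl; apply: lerD.
  apply: le_trans (ha c d) _; apply: E0; rewrite ?geq_minl//.
    by rewrite sqrtr_ge0 le_grad_norm_energy_norm.
  by rewrite sqrtr_ge0 le_grad_norm_energy_norm.
have -> : normc (k ^+ 2)%:C%C = k ^+ 2.
  by rewrite /= expr0n addr0 sqrtr_sqr ger0_norm// exprn_ge0// ltW.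
apply: (@le_trans _ _ (Cm * (H ^+ q2.+1 * (k * norm2 (leb R n) Om (fn (comb phi c)))
                     * (k * norm2 (leb R n) Om (fn (comb phi d)))))).
  apply: le_trans (ler_wpM2l (exprn_ge0 2 (ltW k0)) (hm c d)) _.
  by rewrite le_eqVlt; apply/orP; left; apply/eqP; ring.
apply: E0; rewrite ?geq_minr// le_energy_norm ?(ltW k0)// mulr_ge0 ?sqrtr_ge0//;
  exact: ltW.
Qed.

Lemma weak_solution_ae (k : R) f f' g g' (u : sobolev Om 1) :
  sq_integrable (leb R n) Om f -> sq_integrable (leb R n) Om f' ->
  sq_integrable (surf R n) (boundary Om) g ->
  sq_integrable (surf R n) (boundary Om) g' ->
  eq_ae (leb R n) Om f f' -> eq_ae (surf R n) (boundary Om) g g' ->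
  weak_solution T k f g u -> weak_solution T k f' g' u.
Proof. by move=> f2 f'2 g2 g'2 ff gg w v; rewrite w; exact: load_ae. Qed.

Lemma galerkin_solution_ae (k : R) f g g' (c : 'cV[R[i]]_N) :
  sq_integrable (leb R n) Om f ->
  sq_integrable (surf R n) (boundary Om) g ->
  sq_integrable (surf R n) (boundary Om) g' ->
  eq_ae (surf R n) (boundary Om) g g' ->
  galerkin_solution T phi k f g c -> galerkin_solution T phi k f g' c.
Proof.
by move=> f2 g2 g'2 gg w v; rewrite w; exact: (load_ae T _ f2 f2 g2 g'2 (eq_ae_refl _ _ _) gg).
Qed.

End surrogate.

(** * Error estimate *)

Theorem theorem4p1 (R : realType) (n : nat) (hn : n = 2%N \/ n = 3%N)
  (* geometry *)
  (Oh Om : set 'rV[R]_n) (geo : 'rV[R]_n -> 'rV[R]_n)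
  (hOh : is_domain Oh)
  (hOm : lipschitz_domain Om)
  (hconvex : convex_set (M := 'rV[R]_n) Om)
  (hsmooth : smooth_on Oh geo)
  (himage : geo @` Oh = Om)
  (hdet : forall x, Oh x -> 0 < \det (jacobian geo x))
  (T : trace_operator Om)
  (* wave numbers, order, discrete spaces *)
  (k0 k1 : R) (hk0 : 1 <= k0) (hk01 : k0 <= k1)
  (p : nat) (hp : (0 < p)%N)
  (hreg : has_regularity T p.-1)
  (V : forall (h : R) (N : nat), ('I_N -> sobolev Om 1) -> Prop)
  (hV : forall h N (phi : 'I_N -> sobolev Om 1), V h N phi -> order_basis Oh geo p h phi)
  (cp ch : R) (hcp : 0 < cp) (hch : 0 < ch)
  (hsuit : suitable_constants T k0 k1 p V cp ch)
  (hpk : cp * ln k1 <= p%:R)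
  (* surrogate quality *)
  (q1 q2 : nat) (Ca Cm theta : R) :
  exists H0 C : R, [/\ 0 < H0, 0 < C &
  forall (k : R) (h : R) (N : nat) (phi : 'I_N -> sobolev Om 1)
    (m : nat) (Xi : 'I_n -> seq R) (H : R) (Kt Mt : 'M[R[i]]_N)
    (f : sobolev Om p.-1) (g : 'rV[R]_n -> R[i]) (u : sobolev Om 1),
  k0 <= k -> k <= k1 ->
  V h N phi -> (p < m)%N -> h = (m - p)%:R^-1 -> h <= ch * (ln k1 / k1) ->
  sampling_knots p m h theta Xi -> H = sampling_length Xi -> 0 < H -> H <= H0 ->
  (forall c d : 'cV[R[i]]_N,
    normc (form_a (comb phi c) (comb phi d) - matrix_form Kt c d) <=
    Ca * (H ^+ q1.+1 * grad_norm (comb phi c) * grad_norm (comb phi d))) ->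
  (forall c d : 'cV[R[i]]_N,
    normc (form_m (comb phi c) (comb phi d) - matrix_form Mt c d) <=
    Cm * (H ^+ q2.+1 * norm2 (leb R n) Om (fn (comb phi c))
                     * norm2 (leb R n) Om (fn (comb phi d)))) ->
  trace_space T p g ->
  weak_solution T k (fn f) g u ->
  (exists! ut, surrogate_solution T phi Kt Mt k (fn f) g ut) /\
  forall ut, surrogate_solution T phi Kt Mt k (fn f) g ut ->
    energy_norm k (u - comb phi ut) <=
      C * ((h * k) ^+ p * (sobolev_norm f + trace_norm T p g)
           + H ^+ (minn q1 q2).+1 * (norm2 (leb R n) Om (fn f)
                                     + norm2 (surf R n) (boundary Om) g))
    /\
    (eq_ae (surf R n) (boundary Om) g (fun=> 0) ->
     forall f1 : sobolev Om 1, eq_ae (leb R n) Om (fn f1) (fn f) ->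
     energy_norm k (u - comb phi ut) <=
       C * (k^-1 * ((h * k) ^+ p * sobolev_norm f
                    + H ^+ (minn q1 q2).+1 * sobolev_norm f1))) ].
Proof.
have [C0 C0_gt0 theory] := hsuit hpk.
have C0_ge0 := ltW C0_gt0.
pose S := 1 + 2 * C0 ^+ 2 * k1.
pose K := `|Ca| + `|Cm|.
have k1_gt0 : 0 < k1 by apply: lt_le_trans hk01; exact: lt_le_trans ltr01 hk0.
have S_gt0 : 0 < S by rewrite addr_gt0// !mulr_gt0// exprn_gt0.
have S_ge0 := ltW S_gt0.
have K_ge0 : 0 <= K by rewrite addr_ge0.
have SK_ge0 : 0 <= S * K by rewrite mulr_ge0// ltW.
have H0_gt0 : 0 < (1 + 2 * (S * K))^-1.
  by rewrite invr_gt0; apply: ltr_wpDr => //; rewrite mulr_ge0.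
have C_gt0 : 0 < C0 + 2 * (S * K) * C0 ^+ 2.
  by apply: ltr_wpDr => //; rewrite !mulr_ge0.
(* this bound on [H] gives both [H <= 1] and [S * K * H <= 1 / 2] *)
exists (1 + 2 * (S * K))^-1, (C0 + 2 * (S * K) * C0 ^+ 2); split=> //.
move=> k h N phi m Xi H Kt Mt f g u k0k kk1 Vphi _ _ hh _ _ H_gt0 HH0 ha hm tg uw.
have k_gt0 : 0 < k by apply: lt_le_trans k0k; exact: lt_le_trans ltr01 hk0.
have th := theory k h N phi k0k kk1 hh Vphi.
have [li _] := hV h N phi Vphi.
have H_le1 : H <= 1.
  by apply: le_trans HH0 _; rewrite invf_le1 ?lerDl ?mulr_ge0// -invr_gt0.
set Hq := H ^+ (minn q1 q2).+1.
have Hq_ge0 : 0 <= Hq by rewrite exprn_ge0// ltW.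
have Hq_le : Hq <= H.
  by rewrite -[leRHS]expr1 ler_wiXn2l// ltW.
set E := fun c : 'cV[R[i]]_N => energy_norm k (comb phi c).
pose A := helmholtz_matrix T phi (stiffness phi) (mass phi) k.
pose At := helmholtz_matrix T phi Kt Mt k.
have E_ge0 c : 0 <= E c by exact: energy_norm_ge0.
have E_eq0 c : E c = 0 -> c = 0 by exact: energy_norm_eq0 k_gt0 li.
have E_triangle c d : E (c + d) <= E c + E d.
  by rewrite /E combD; exact: energy_norm_triangle.
have delta_ge0 : 0 <= K * Hq by exact: mulr_ge0.
have stable c eps : 0 <= eps ->
    (forall d, normc (pairing d (A *m c)) <= eps * E d) -> E c <= S * eps.
  move=> eps0 res; apply: (@le_trans _ _ ((1 + 2 * C0 ^+ 2 * k) * eps)).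
    apply: (discrete_inf_sup C0_gt0 k_gt0 li th eps0) => d.
    by rewrite helmholtz_comb; exact: res.
  by rewrite ler_wpM2r// lerD2l ler_wpM2l// !mulr_ge0.
have close := surrogate_close T k_gt0 (introT andP (conj H_gt0 H_le1)) ha hm.
have small : S * (K * Hq) <= 2^-1.
  have : S * K * H <= 2^-1.
    have : H * (1 + 2 * (S * K)) <= 1.
      by rewrite -ler_pdivlMr ?div1r// -invr_gt0.
    by move: (ltW H_gt0); nra.
  by apply: le_trans; rewrite mulrA ler_wpM2l.
have Atu : At \in unitmx := perturbed_unitmx E_ge0 E_eq0 delta_ge0 stable close small.
have f2 := fn_sq_integrable f.
have g2 := trace_space_sq_integrable tg.
split.
  exists (invmx At *m load_vector T phi (fn f) g); split.
    by apply/surrogate_solutionE; rewrite mulKVmx.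
  by move=> ut /surrogate_solutionE <-; rewrite mulKmx.
move=> ut /surrogate_solutionE utE.
have [c [cgal _]] := discrete_wellposed th f2 g2.
have err : E (ut - c) <= 2 * (S * (K * Hq)) * E c.
  apply: (perturbation_error E_ge0 E_triangle (ltW S_gt0) delta_ge0 stable close small).
  by rewrite utE (galerkin_solutionE f2 g2 cgal).
have cu : E c <= C0 * energy_norm k u := discrete_stability th f2 g2 uw cgal.
(* Both estimates have the same form: [X] is the recalled bound for the Galerkin
   error, [Y] the recalled bound for the solution itself. *)
have conclude X Y : 0 <= Y -> energy_norm k (u - comb phi c) <= C0 * X ->
    energy_norm k u <= C0 * Y ->
    energy_norm k (u - comb phi ut) <= (C0 + 2 * (S * K) * C0 ^+ 2) * (X + Hq * Y).
  move=> Y0 leX leY.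
  have X0 : 0 <= X.
    by rewrite -(pmulr_rge0 _ C0_gt0); apply: le_trans leX; exact: energy_norm_ge0.
  have -> : u - comb phi ut = (u - comb phi c) - comb phi (ut - c).
    by rewrite combB opprB addrA subrK.
  apply: le_trans (energy_norm_triangle _ _ _) _; rewrite energy_normN.
  have Ec : E c <= C0 ^+ 2 * Y.
    by apply: le_trans cu _; rewrite expr2 -mulrA ler_pM2l.
  have err' : E (ut - c) <= 2 * (S * K) * C0 ^+ 2 * (Hq * Y).
    apply: le_trans err _.
    rewrite (_ : 2 * (S * K) * _ * _ = 2 * (S * (K * Hq)) * (C0 ^+ 2 * Y)); last by ring.
    by rewrite ler_wpM2l// !mulr_ge0// ltW.
  apply: le_trans (lerD leX err') _; set Z := 2 * (S * K) * C0 ^+ 2.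
  have -> : (C0 + Z) * (X + Hq * Y) = C0 * X + Z * (Hq * Y) + (C0 * (Hq * Y) + Z * X).
    by ring.
  by rewrite lerDl addr_ge0// !mulr_ge0.
split.
  apply: conclude; first by rewrite addr_ge0 ?sqrtr_ge0.
    exact: (discrete_error th tg uw cgal).
  exact: (continuous_stability th f2 g2 uw).
move=> g0 f1 f1f.
have z2 := sq_integrable0 (surf R n) (boundary Om).
have f12 := fn_sq_integrable f1.
have uw0 := weak_solution_ae f2 f2 g2 z2 (eq_ae_refl _ _ _) g0 uw.
have uw1 := weak_solution_ae f2 f12 g2 z2 (eq_ae_sym f1f) g0 uw.
have cgal0 := galerkin_solution_ae f2 g2 z2 g0 cgal.
rewrite (mulrDr k^-1) (mulrCA k^-1 Hq).
apply: conclude.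
- by rewrite mulr_ge0 ?sqrtr_ge0// invr_ge0 ltW.
- by apply: le_trans (discrete_error_homogeneous th uw0 cgal0) _; rewrite (mulrA k^-1) (mulrC k^-1).
- exact: (continuous_stability_H1 th uw1).
Qed.
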